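(* Let $n,k\ge 1$ be integers. Let $\mathcal{F}$ be a family of $2n+k-2$ sets of edges in a bipartite graph, such that the union of any $k$ members of $\mathcal{F}$ contains a matching of size $n$. Then there exists an $\mathcal{F}$-rainbow matching of size $n$.
   Context: ''Family'' means multiset: members may repeat, and repeated copies count as distinct members. For a family $\mathcal{F}=(F_1,\dots,F_m)$ of sets, an $\mathcal{F}$-rainbow set is the image of a partial choice function of $\mathcal{F}$, i.e. a set $\{x_{i_j}\mid j\le r\}$ where $1\le i_1<\dots<i_r\le m$ and $x_{i_j}\in F_{i_j}$. An $\mathcal{F}$-rainbow matching is an $\mathcal{F}$-rainbow set of edges that is a matching (its edges are pairwise disjoint); its size is its number of edges. *)

(* Defs.v *)
From mathcomp Require Import all_boot finmap.
From mathcomp Require Import boolp classical_sets.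

Set Implicit Arguments.
Unset Strict Implicit.
Unset Printing Implicit Defensive.

Local Open Scope classical_set_scope.

(* The vertex type is not required to be finite. *)
Record sgraph (V : choiceType) := SGraph {
  adj : V -> V -> Prop;
  adj_sym : forall x y, adj x y -> adj y x;
  adj_irrefl : forall x, ~ adj x x
}.

Definition edges (V : choiceType) (G : sgraph V) : set {fset V} :=
  [set e | exists x y, adj G x y /\ e = [fset x; y]%fset].

Definition bipartite (V : choiceType) (G : sgraph V) : Prop :=
  exists A : set V, forall x y, adj G x y -> (A x <-> ~ A y).

Definition matching (V : choiceType) (G : sgraph V) (M : {fset {fset V}}) : Prop :=
  (forall e, e \in M -> edges G e) /\
  (forall e f, e \in M -> f \in M -> e <> f -> [disjoint e & f]%fset).

(* A family of m sets is a function on 'I_m, so that repeated members carry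
   distinct indices. *)
Definition partial_choice (T : Type) (m : nat) (F : 'I_m -> set T)
    (c : 'I_m -> option T) : Prop :=
  forall i x, c i = Some x -> F i x.

Definition rainbow (T : choiceType) (m : nat) (F : 'I_m -> set T)
    (R : {fset T}) : Prop :=
  exists c, partial_choice F c /\ forall x, x \in R <-> exists i, c i = Some x.

Definition rainbow_matching (V : choiceType) (G : sgraph V) (m : nat)
    (F : 'I_m -> set {fset V}) (R : {fset {fset V}}) : Prop :=
  rainbow F R /\ matching G R.

(* Main.v *)
(* Augment a rainbow matching of size p < n.  Grow a forest of alternating
   paths from the vertices of one side that are left free, giving each new
   forest edge a colour of its own; when t matching edges have been reached, at
   most p + t <= 2(n - 1) colours are in use, so k unused colours remain, and
   their union contains a matching of size n.  Only p of its edges can be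
   incident to an unreached matching edge on the first side or to a reached one
   on the second side, so some edge extends the forest or completes an
   augmenting path. *)
Require Import Defs.
From mathcomp Require Import all_boot finmap.
From mathcomp Require Import boolp classical_sets.
From mathcomp Require Import zify.

Set Implicit Arguments.
Unset Strict Implicit.
Unset Printing Implicit Defensive.

Local Open Scope classical_set_scope.

(** * Counting in matchings given as lists of pairs *)

Lemma uniq_map_inj_in (E X : eqType) (f : E -> X) (s : seq E) :
  uniq (map f s) -> {in s &, injective f}.
Proof.
elim: s => //= a s IHs /andP[fas us] x y.
rewrite !inE => /predU1P[->|xs] /predU1P[->|ys] // e.
- by rewrite e map_f in fas.
- by rewrite -e map_f in fas.
- exact: IHs.
Qed.

Lemma count_mem_map_leq (E X : eqType) (f : E -> X) (s : seq E) (xs : seq X) :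
  uniq (map f s) -> count (fun e => f e \in xs) s <= size xs.
Proof.
move=> us.
rewrite -(count_map f (mem xs)) -size_filter; apply: uniq_leq_size.
  exact: filter_uniq.
by move=> x; rewrite mem_filter => /andP[].
Qed.

(** Distinct edges of a matching have distinct ends on each side, so each forbidden vertex rules out
    at most one edge of [N]. *)
Lemma exists_edge_avoiding (X Y : eqType) (N : seq (X * Y)) (xs : seq X)
    (ys : seq Y) :
  uniq (map fst N) -> uniq (map snd N) -> size xs + size ys < size N ->
  exists2 e, e \in N & (e.1 \notin xs) && (e.2 \notin ys).
Proof.
move=> u1 u2 lt_N; apply/hasP; apply: contraLR lt_N => /hasPn noN.
rewrite -leqNgt.
have := leq_add (count_mem_map_leq xs u1) (count_mem_map_leq ys u2).
apply: leq_trans.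
rewrite -count_predUI.
have -> : count (predU (fun e => e.1 \in xs) (fun e => e.2 \in ys)) N = size N.
  apply/eqP; rewrite -all_count; apply/allP => e /noN /=.
  by rewrite negb_and !negbK.
exact: leq_addr.
Qed.

(** * Rainbow matchings as lists of coloured edges, and their augmentation *)

Section ColouredMatching.

Variables (I : finType) (X Y : eqType) (T : I -> X -> Y -> Prop).

Implicit Types (M U W : seq (I * (X * Y))) (t : I * (X * Y)).

Definition colour t := t.1.
Definition left_end t := t.2.1.
Definition right_end t := t.2.2.

(** Each entry carries an edge together with the colour that supplies it, so the choice function and
    the matching form a single object, and rerouting becomes list surgery. *)
Definition coloured_matching M :=
  [/\ uniq (map colour M), uniq (map left_end M), uniq (map right_end M)
    & forall t, t \in M -> T (colour t) (left_end t) (right_end t)].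

Lemma coloured_matching_perm M M' :
  perm_eq M M' -> coloured_matching M -> coloured_matching M'.
Proof.
move=> MM' [uc ul ur MT]; split.
- by rewrite -(perm_uniq (perm_map colour MM')).
- by rewrite -(perm_uniq (perm_map left_end MM')).
- by rewrite -(perm_uniq (perm_map right_end MM')).
- by move=> t; rewrite -(perm_mem MM'); apply: MT.
Qed.

Lemma coloured_matching_cons t M :
  colour t \notin map colour M -> left_end t \notin map left_end M ->
  right_end t \notin map right_end M ->
  T (colour t) (left_end t) (right_end t) ->
  coloured_matching M -> coloured_matching (t :: M).
Proof.
move=> tc tl tr tT [uc ul ur MT]; split => /=; rewrite ?tc ?tl ?tr //.
by move=> s; rewrite inE => /predU1P[-> //|]; apply: MT.
Qed.

Lemma coloured_matching_behead t M :
  coloured_matching (t :: M) -> coloured_matching M.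
Proof.
move=> [/andP[_ uc] /andP[_ ul] /andP[_ ur] MT]; split=> // s sM.
by apply: MT; rewrite inE sM orbT.
Qed.

(* [U] is the unreached part of the current matching, [ys] lists the right ends
   of its reached edges, and [C] contains all colours used so far.  Rerouting
   the reached part along alternating paths into [W] frees any prescribed left
   vertex [x] that is not covered by [U]. *)
Definition reroutable U (ys : seq Y) (C : {set I}) :=
  forall x, x \notin map left_end U ->
  exists W, [/\ map right_end W = ys, x \notin map left_end W,
    coloured_matching (W ++ U) & {subset map colour (W ++ U) <= C}].

(** The fresh edge from [x] to [right_end t] makes [t] reached. The only newly prescribable left
    vertex is [left_end t]; it is freed by first freeing [x] and then trading [t] for the fresh
    edge. The colour of [t] is already in [C], so only [i] is added. *)
Lemma reroutable_step U ys (C : {set I}) t i x :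
  i \notin C -> T i x (right_end t) -> x \notin map left_end (t :: U) ->
  reroutable (t :: U) ys C ->
  reroutable U (right_end t :: ys) (i |: C)%SET.
Proof.
move=> iC Tix xtU reU z zU.
have [zt|zt] := eqVneq z (left_end t).
  have [W [Wy xW MW WC]] := reU x xtU.
  have pW : perm_eq (W ++ t :: U) (t :: W ++ U).
    by rewrite (perm_catCA W [:: t] U).
  have MW' := coloured_matching_perm pW MW.
  have tl : left_end t \notin map left_end (W ++ U) by case: MW' => _ /andP[].
  have tr : right_end t \notin map right_end (W ++ U).
    by case: MW' => _ _ /andP[].
  have WUC : {subset map colour (W ++ U) <= C}.
    move=> j jW; apply: WC.
    by rewrite (perm_mem (perm_map colour pW)) /= inE jW orbT.
  move: xtU; rewrite inE negb_or => /andP[xt xU].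
  exists ((i, (x, right_end t)) :: W); split.
  - by rewrite /= Wy.
  - rewrite /= inE negb_or zt eq_sym xt /=.
    by move: tl; rewrite map_cat mem_cat negb_or => /andP[].
  - apply: coloured_matching_cons => //.
    + by apply: contra iC; apply: WUC.
    + by rewrite map_cat mem_cat negb_or xW.
    + exact: coloured_matching_behead MW'.
  - move=> j; rewrite /= !inE => /predU1P[->|/WUC ->]; by rewrite ?eqxx ?orbT.
(* For any other [z] the edge [t] is kept and merely moves to the reached part; colour [i] is not
   spent. *)
have [|W [Wy zW MW WC]] := reU z.
  by rewrite /= inE negb_or zt.
have pW : perm_eq (W ++ t :: U) ((t :: W) ++ U).
  by rewrite (perm_catCA W [:: t] U).
exists (t :: W); split.
- by rewrite /= Wy.
- by rewrite /= inE negb_or zt.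
- exact: coloured_matching_perm MW.
- move=> j; rewrite -(perm_mem (perm_map colour pW)) => /WC jC.
  by rewrite !inE jC orbT.
Qed.

Lemma reroutable_perm U U' ys (C : {set I}) :
  perm_eq U U' -> reroutable U ys C -> reroutable U' ys C.
Proof.
move=> UU' reU x; rewrite -(perm_mem (perm_map left_end UU')) => /reU.
case=> W [Wy xW MW WC]; exists W; split=> //.
- by apply: coloured_matching_perm MW; rewrite perm_cat2l.
- move=> j jW; apply: WC; move: jW.
  by rewrite !map_cat !mem_cat (perm_mem (perm_map colour UU')).
Qed.

Lemma reroutable_start M :
  coloured_matching M -> reroutable M [::] [set i in map colour M]%SET.
Proof. by move=> MM x xM; exists [::]; split=> // i; rewrite inE. Qed.

Lemma reroutable_augment U ys (C : {set I}) i x y :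
  reroutable U ys C -> i \notin C -> T i x y ->
  x \notin map left_end U -> y \notin ys -> y \notin map right_end U ->
  exists2 M, coloured_matching M & size M = (size U + size ys).+1.
Proof.
move=> reU iC Tixy xU yys yU; have [W [Wy xW MW WC]] := reU x xU.
exists ((i, (x, y)) :: W ++ U); last by rewrite /= size_cat -Wy size_map addnC.
apply: coloured_matching_cons => //.
- by apply: contra iC; apply: WC.
- by rewrite map_cat mem_cat negb_or xW.
- by rewrite map_cat mem_cat negb_or Wy yys.
Qed.

Variables (n k : nat).
Hypothesis cardI : 2 * n + k - 2 <= #|I|.
Hypothesis cooperative : forall K : {set I}, #|K| = k ->
  exists N : seq (X * Y), [/\ uniq (map fst N), uniq (map snd N), size N = n
    & forall e, e \in N -> exists2 i, i \in K & T i e.1 e.2].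

Lemma exists_fresh_edge (C : {set I}) (xs : seq X) (ys : seq Y) :
  #|C| <= 2 * n - 2 -> size xs + size ys < n ->
  exists i x y, [/\ i \notin C, T i x y, x \notin xs & y \notin ys].
Proof.
move=> leC ltn.
have /card_geqP[s [us ss sC]] : k <= #|(~: C)%SET|.
  by have := cardsC C; lia.
have [|N [N1 N2 sN NK]] := @cooperative [set j in s]%SET.
  by rewrite cardsE (card_uniqP us).
have [|[x y] xyN /andP[/= xU yys]] :=
    exists_edge_avoiding N1 N2 (xs := xs) (ys := ys).
  by rewrite sN.
have [i /= + Tixy] := NK _ xyN; rewrite inE => /sC; rewrite inE => iC.
by exists i, x, y.
Qed.

(** Induction on the unreached part. Reaching an edge shortens [U] by one, lengthens [ys] by one and
    spends one colour, so the bound on [C] persists while the size of the matching stays fixed. Once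
    [U] is empty, the fresh edge must end at a free right vertex. *)
Lemma augment_reroutable U ys (C : {set I}) :
  reroutable U ys C -> #|C| <= 2 * size ys + size U ->
  size U + size ys < n ->
  exists2 M, coloured_matching M & size M = (size U + size ys).+1.
Proof.
have [m] := ubnP (size U); elim: m U ys C => // m IHm U ys C ltm reU leC ltn.
(* The colours used number at most twice the size of the matching, hence at most [2 * n - 2]. *)
have [||i [x [y [iC Tixy xU yys]]]] :=
  @exists_fresh_edge C (map left_end U) ys; rewrite ?size_map //; first by lia.
have [/mapP[t tU yt]|yU] := boolP (y \in map right_end U); last first.
  exact: (reroutable_augment reU iC Tixy).
have pU := perm_to_rem tU.
have sU := perm_size pU; rewrite /= in sU.
rewrite (perm_mem (perm_map left_end pU)) in xU; rewrite yt in Tixy.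
have := reroutable_step iC Tixy xU (reroutable_perm pU reU).
move=> /IHm[|||M MM sM].
- by lia.
- by rewrite cardsU1 iC /=; lia.
- by move=> /=; lia.
- by exists M; rewrite // sM /=; lia.
Qed.

Lemma exists_coloured_matching p :
  p <= n -> exists2 M, coloured_matching M & size M = p.
Proof.
elim: p => [|p IHp] ltp; first by exists [::].
have [M MM sM] := IHp (ltnW ltp).
have [||M' MM' sM'] := augment_reroutable (reroutable_start MM).
- have [uc _ _ _] := MM.
  by rewrite cardsE (card_uniqP uc) size_map.
- by rewrite sM addn0.
- by exists M'; rewrite // sM' sM addn0.
Qed.

End ColouredMatching.

(** * Translation between unordered edges of a bipartite graph and oriented pairs *)

Section Orientation.

Variables (V : choiceType) (A : set V).

Implicit Types (p q : V * V).

Definition edge_of p : {fset V} := [fset p.1; p.2]%fset.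
Definition oriented p := A p.1 /\ ~ A p.2.

(** A common vertex lies on one side of the bipartition, so it occupies the same position in both
    pairs. *)
Lemma oriented_meet p q v : oriented p -> oriented q ->
  v \in edge_of p -> v \in edge_of q -> p.1 = q.1 \/ p.2 = q.2.
Proof.
move=> [Ap1 Ap2] [Aq1 Aq2]; rewrite !inE.
move=> /orP[]/eqP-> /orP[]/eqP e; [by left| | |by right].
- by rewrite e in Ap1.
- by rewrite e in Ap2.
Qed.

Lemma edge_of_inj p q :
  oriented p -> oriented q -> edge_of p = edge_of q -> p = q.
Proof.
case: p q => [a b] [c d] [/= Aa Ab] [/= Ac Ad] /fsetP E.
have := E a; rewrite !inE eqxx /= => /esym/orP[]/eqP ea; last by rewrite ea in Aa.
have := E b; rewrite !inE eqxx orbT => /esym/orP[]/eqP eb; first by rewrite eb in Ab.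
by rewrite ea eb.
Qed.

Lemma orient_seq (s : seq {fset V}) :
  (forall e, e \in s -> exists2 p, oriented p & e = edge_of p) ->
  exists2 N, s = map edge_of N & forall p, p \in N -> oriented p.
Proof.
elim: s => [|e s IHs] os; first by exists [::].
have [f fs|N sN oN] := IHs; first by apply: os; rewrite inE fs orbT.
have [p op ep] := os e (mem_head e s).
exists (p :: N); first by rewrite /= -sN ep.
by move=> q; rewrite inE => /predU1P[-> //|]; apply: oN.
Qed.

Lemma matching_orientation (G : sgraph V) (M : {fset {fset V}}) :
  (forall x y, adj G x y -> (A x <-> ~ A y)) -> matching G M ->
  exists N : seq (V * V), [/\ uniq (map fst N), uniq (map snd N),
    size N = #|` M|%fset & forall p, p \in N -> oriented p /\ edge_of p \in M].
Proof.
move=> bipA [ME Mdisj].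
have [e eM|N MN oN] := @orient_seq (enum_fset M).
  have [x [y [xy ->]]] := ME e eM.
  have [Ax|Ax] := pselect (A x); first by exists (x, y); split=> //; apply/(bipA x y).
  exists (y, x); last by rewrite /edge_of fsetUC.
  by split=> //; apply: contrapT => Ay; apply/Ax/(bipA x y).
have NM p : p \in N -> edge_of p \in M.
  by move=> pN; have := map_f edge_of pN; rewrite -MN.
have uN : uniq N by apply: (@map_uniq _ _ edge_of); rewrite -MN fset_uniq.
(* Disjointness in the form of injectivity: applied to first and to second ends, it gives both
   [uniq] claims. *)
have meet p q v : p \in N -> q \in N -> v \in edge_of p -> v \in edge_of q -> p = q.
  move=> pN qN vp vq; apply: edge_of_inj; [exact: oN|exact: oN|].
  apply: contrapT => /(Mdisj _ _ (NM p pN) (NM q qN)) /fdisjointP /(_ _ vp).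
  by rewrite vq.
exists N; split.
- rewrite map_inj_in_uniq // => p q pN qN e; apply: (meet p q p.1) => //.
    by rewrite !inE eqxx.
  by rewrite e !inE eqxx.
- rewrite map_inj_in_uniq // => p q pN qN e; apply: (meet p q p.2) => //.
    by rewrite !inE eqxx orbT.
  by rewrite e !inE eqxx orbT.
- by rewrite -(size_map edge_of) -MN.
- by move=> p pN; split; [apply: oN|apply: NM].
Qed.

Lemma rainbow_of_coloured_matching (G : sgraph V) (m : nat)
    (F : 'I_m -> set {fset V}) (M : seq ('I_m * (V * V))) :
  (forall i, F i `<=` edges G) ->
  coloured_matching (fun i x y => oriented (x, y) /\ F i (edge_of (x, y))) M ->
  exists R : {fset {fset V}}, rainbow_matching G F R /\ #|` R|%fset = size M.
Proof.
move=> FG [uc ul ur MT].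
have uM := map_uniq uc.
have injc := uniq_map_inj_in uc.
have injl := uniq_map_inj_in ul.
have injr := uniq_map_inj_in ur.
have oM t : t \in M -> oriented t.2 by case: t => i [x y] /MT[].
have FM t : t \in M -> F t.1 (edge_of t.2) by case: t => i [x y] /MT[].
have inj v t u : t \in M -> u \in M ->
    v \in edge_of t.2 -> v \in edge_of u.2 -> t = u.
  move=> tM uM' vt vu.
  by have [/injl|/injr] := oriented_meet (oM t tM) (oM u uM') vt vu; apply.
have injE : {in M &, injective (fun t => edge_of t.2)}.
  move=> t u tM uM' e; apply: (inj t.2.1) => //; first by rewrite !inE eqxx.
  by rewrite -e !inE eqxx.
pose c i := ohead [seq edge_of t.2 | t <- M & colour t == i].
have cP i e : c i = Some e <-> exists2 t, t \in M & colour t = i /\ e = edge_of t.2.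
  rewrite /c; split=> [|[t tM [ti ->]]].
    case Ef: (filter _ M) => [//|t s] [<-].
    have : t \in [seq t <- M | colour t == i] by rewrite Ef mem_head.
    by rewrite mem_filter => /andP[/eqP ti tM]; exists t.
  have : t \in [seq t <- M | colour t == i] by rewrite mem_filter ti eqxx.
  case Ef: (filter _ M) => [//|u s] _ /=.
  have : u \in [seq t <- M | colour t == i] by rewrite Ef mem_head.
  rewrite mem_filter => /andP[/eqP ui uM'].
  by rewrite (injc u t uM' tM) // ui ti.
exists [fset edge_of t.2 | t in M]%fset; split; last first.
  by rewrite card_in_imfset //= undup_id.
split.
  exists c; split=> [i e /cP[t tM [<- ->]]|e]; first exact: FM.
  split=> [/imfsetP[t /= tM ->]|[i /cP[t tM [_ ->]]]].
    by exists (colour t); apply/cP; exists t.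
  by apply/imfsetP; exists t.
split=> [e /imfsetP[t /= tM ->]|e f].
  by apply: FG; apply: FM.
move=> /imfsetP[t /= tM ->] /imfsetP[u /= uM' ->] ne.
apply/fdisjointP => v vt; apply/negP => vu.
by apply: ne; rewrite (inj v t u).
Qed.

End Orientation.

Theorem theorem1p6 (n k : nat) (V : choiceType) (G : sgraph V)
    (F : 'I_(2 * n + k - 2) -> set {fset V}) :
  (1 <= n)%N -> (1 <= k)%N ->
  bipartite G ->
  (forall i, F i `<=` edges G) ->
  (forall K : {set 'I_(2 * n + k - 2)}, #|K| = k ->
     exists M : {fset {fset V}},
       [/\ matching G M, #|` M|%fset = n
         & forall e, e \in M -> (\bigcup_(i in [set` K]) F i) e]) ->
  exists R : {fset {fset V}}, rainbow_matching G F R /\ #|` R|%fset = n.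
Proof.
move=> n1 k1 [A bipA] FG coop.
(* Both vertex types become [V]; requiring the orientation in [T] keeps the two sides apart. *)
pose T i x y := oriented A (x, y) /\ F i (edge_of (x, y)).
have [||M MM sM] := @exists_coloured_matching _ _ _ T n k _ _ n (leqnn n).
- by rewrite card_ord.
- move=> K /coop[M [MM sM MF]].
  have [N [N1 N2 sN NM]] := matching_orientation bipA MM.
  exists N; split=> //; first by rewrite sN.
  move=> [x y] /NM[oxy /MF[i iK Fi]].
  by exists i.
- have [R [RM sR]] := rainbow_of_coloured_matching FG MM.
  by exists R; rewrite sR.
Qed.
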